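(* Let $F\in\mathbb{C}^{n\times n}$ be Hermitian positive definite and let $G\in\mathbb{C}^{n\times n}$ be positive semidefinite (in general non-Hermitian). Define the $2n\times 2n$ block matrices $$ \mathbf{Q}=\begin{pmatrix} F & -G^* \\ G & F+G+G^* \end{pmatrix},\qquad \mathbf{R}=\begin{pmatrix} F & -\tfrac12(G+G^* ) \\ \tfrac12(G+G^* ) & F+(G+G^* ) \end{pmatrix}. $$ If $\lambda\in\mathbb{C}$ is an eigenvalue of $\mathbf{R}^{-1}\mathbf{Q}$, then $\Re(\lambda)=1$ and there exists a nonzero vector $x\in\mathbb{C}^n$ such that, for one of the two choices of sign, $$ \Im(\lambda)=\pm\frac{1}{2\mathrm{i}}\,\frac{x^*(G^*-G)x}{x^*\left(F+\tfrac12(G+G^* )\right)x}. $$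
   Context: $A^*$ denotes the conjugate transpose of $A$, $\mathrm{i}=\sqrt{-1}$, and $\Re(z)$, $\Im(z)$ denote the real and imaginary parts of $z\in\mathbb{C}$. A matrix $A\in\mathbb{C}^{n\times n}$, not necessarily Hermitian, is called positive semidefinite if $\Re(x^*Ax)\ge 0$ for every $x\in\mathbb{C}^n$ (equivalently, $A+A^*$ is Hermitian positive semidefinite). A Hermitian positive definite matrix is a Hermitian matrix $A$ with $x^*Ax>0$ for all nonzero $x$. Under these assumptions the matrix $\mathbf{R}$ is nonsingular. *)

(* Defs.v *)
From HB Require Import structures.
From mathcomp Require Export all_boot all_order all_algebra.
From mathcomp Require Export sesquilinear spectral complex.
From mathcomp Require Export reals.

Set Implicit Arguments.
Unset Strict Implicit.
Unset Printing Implicit Defensive.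

Import Order.TTheory GRing.Theory Num.Theory.
Local Open Scope ring_scope.
Local Open Scope complex_scope.
Local Open Scope sesquilinear_scope.

Section Definitions.
Variables (R : realType) (n : nat).
Implicit Types (A F G : 'M[R[i]]_n) (x : 'cV[R[i]]_n).

Definition qform A x : R[i] := (x ^t* *m A *m x) 0 0.

(* [A] need not be Hermitian. *)
Definition pos_semidef A : Prop := forall x, 0 <= 'Re (qform A x).

(* In the partial order of R[i], [0 < z] means that [z] is real and positive. *)
Definition hermitian_posdef A : Prop :=
  A \is hermsymmx /\ forall x, x != 0 -> 0 < qform A x.

Definition Qmx F G : 'M[R[i]]_(n + n) :=
  block_mx F    (- G ^t*)
           G    (F + G + G ^t*).

Definition Rmx F G : 'M[R[i]]_(n + n) :=
  block_mx F                         (- (2^-1 *: (G + G ^t*)))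
           (2^-1 *: (G + G ^t*))     (F + (G + G ^t*)).

End Definitions.

(* Main.v *)
Require Import Defs.
From mathcomp Require Import ring.
Import Order.TTheory GRing.Theory Num.Theory.
Local Open Scope ring_scope.
Local Open Scope complex_scope.
Local Open Scope sesquilinear_scope.

(** Put S = F + (G + G^* )/2, which is Hermitian positive definite. Let
    z = (a, b) be a left eigenvector of the pencil (Q, R), so that
    z Q = lambda z R. Right multiplication by the block column (-1, 1) turns
    this into c (F + G^* ) = lambda c S for c = b - a; if c = 0, the first block
    column gives a (F + G) = lambda a S. Either way lambda is the quotient of
    f + g by f + Re g, where f > 0 is the value of F and g that of G or G^* at
    the same vector; hence lambda = 1 + i Im g / (f + Re g). *)

Section HermitianPart.
Set Implicit Arguments.
Unset Strict Implicit.
Variables (R : realType) (n : nat).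
Implicit Types (A B F G : 'M[R[i]]_n) (x : 'cV[R[i]]_n) (c : 'rV[R[i]]_n).

Lemma qformD A B x : qform (A + B) x = qform A x + qform B x.
Proof. by rewrite /qform mulmxDr mulmxDl mxE. Qed.

Lemma qformN A x : qform (- A) x = - qform A x.
Proof. by rewrite /qform mulmxN mulNmx mxE. Qed.

Lemma qformZ t A x : qform (t *: A) x = t * qform A x.
Proof. by rewrite /qform -scalemxAr -scalemxAl mxE. Qed.

Lemma qform_adj A x : qform (A ^t*) x = (qform A x)^*.
Proof.
rewrite /qform.
transitivity (((x ^t* *m A *m x) ^t*) 0 0); last by rewrite !mxE.
by rewrite !trmx_mul !map_mxM trmxCK mulmxA.
Qed.

Lemma adj_eq0 m p (A : 'M[R[i]]_(m, p)) : (A ^t* == 0) = (A == 0).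
Proof.
apply/eqP/eqP => [A0|->]; last by rewrite trmx0 map_mx0.
by rewrite -(trmxCK A) A0 trmx0 map_mx0.
Qed.

Definition hpart F G : 'M[R[i]]_n := F + 2^-1 *: (G + G ^t*).

(** Replacing G by G^* keeps S, so [hpart_eigen] serves both cases of the theorem with the same
    denominator. *)
Lemma hpart_adj F G : hpart F (G ^t*) = hpart F G.
Proof. by rewrite /hpart trmxCK [_ + G]addrC. Qed.

Lemma pos_semidef_adj G : pos_semidef G -> pos_semidef (G ^t*).
Proof. by move=> hG x; rewrite qform_adj Re_conj; exact: hG. Qed.

Lemma qform_hpart F G x : qform (hpart F G) x = qform F x + 'Re (qform G x).
Proof. by rewrite qformD qformZ qformD qform_adj ReE mulrC. Qed.

Lemma qform_hpart_gt0 F G x : hermitian_posdef F -> pos_semidef G ->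
  x != 0 -> 0 < qform (hpart F G) x.
Proof.
by move=> [_ hF] hG x0; rewrite qform_hpart ltr_wpDr ?hG ?hF.
Qed.

Lemma hpart_row_inj F G c : hermitian_posdef F -> pos_semidef G ->
  c *m hpart F G = 0 -> c = 0.
Proof.
move=> hF hG cS0; apply/eqP/contraT; rewrite -adj_eq0.
move=> /(qform_hpart_gt0 hF hG).
by rewrite /qform trmxCK cS0 mul0mx mxE ltxx.
Qed.

(** Right multiplication by c^* turns both sides into quadratic forms at c^*, where the value of S
    is positive and can be divided by. *)
Lemma hpart_eigen F G c (t : R[i]) : hermitian_posdef F -> pos_semidef G ->
  c != 0 -> c *m (F + G) = t *: (c *m hpart F G) ->
  'Re t = 1 /\ 'Im t = - ((2 * 'i)^-1 *
    (qform (G ^t* - G) (c ^t*) / qform (hpart F G) (c ^t*))).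
Proof.
move=> hF hG; rewrite -adj_eq0; set x := c ^t* => x0 cE.
have /matrixP /(_ 0 0) := congr1 (fun B : 'rV_n => B *m x) cE.
rewrite -scalemxAl [RHS]mxE -{1 2}(trmxCK c) -/x.
rewrite -!/(qform _ _).
have s_gt0 := qform_hpart_gt0 hF hG x0.
set s := qform (hpart F G) x in s_gt0 *.
have s0 : s != 0 by rewrite gt_eqF.
(* With g = Re g + i Im g, the part f + Re g is exactly s, so t s = s + i Im g. *)
rewrite qformD [qform G x in LHS]Crect addrA -qform_hpart -/s => ts.
have tE : t = 1 + 'i * ('Im (qform G x) / s).
  by apply: (mulIf s0); rewrite -ts mulrDl mul1r -mulrA divfK.
have imR : 'Im (qform G x) / s \is Num.real.
  by rewrite rpred_div ?Creal_Im ?gtr0_real.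
split; first by rewrite tE Re_rect ?rpred1.
rewrite {1}tE Im_rect ?rpred1 // qformD qformN qform_adj ImE.
(* [ImE] gives Im g = i (conj g - g) / 2; its factor i becomes - 1/i to match (2 i)^-1. *)
rewrite [RHS](_ : _ = - 'i^-1 * (((qform G x)^* - qform G x) / 2) / s).
  by rewrite invCi opprK mulrA.
by rewrite invfM; ring.
Qed.

(** With H = (G + G^* )/2, the second block column of R minus the first is (- H - F, F + 2 H - H),
    that is (- S, S). *)
Lemma Rmx_diff F G (a b : 'rV[R[i]]_n) :
  row_mx a b *m Rmx F G *m col_mx (- 1%:M) 1%:M = (b - a) *m hpart F G.
Proof.
rewrite -mulmxA /Rmx mul_block_col !mulmxN !mulmx1 mul_row_col /hpart.
rewrite -opprD mulmxN mulmxBl addrC; congr (_ *m _ - _).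
rewrite addrCA; congr (_ + _).
by rewrite -{2}[G + G ^t*]scale1r -scaleNr -scalerDl; congr (_ *: _); field.
Qed.

(** In the lower block G cancels and leaves F + G^*, the negative of the upper one. *)
Lemma Qmx_diff F G (a b : 'rV[R[i]]_n) :
  row_mx a b *m Qmx F G *m col_mx (- 1%:M) 1%:M = (b - a) *m (F + G ^t*).
Proof.
rewrite -mulmxA /Qmx mul_block_col !mulmxN !mulmx1 mul_row_col.
rewrite -opprD mulmxN mulmxBl addrC; congr (_ *m _ - _).
by rewrite addrC addrAC addrK.
Qed.

(** Vectors with equal halves are killed by the column difference; for them the first block column
    is used instead. *)
Lemma Rmx_diag F G (a : 'rV[R[i]]_n) :
  row_mx a a *m Rmx F G *m col_mx 1%:M 0 = a *m hpart F G.
Proof.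
by rewrite -mulmxA /Rmx mul_block_col !mulmx1 !mulmx0 !addr0 mul_row_col -mulmxDr.
Qed.

Lemma Qmx_diag F G (a : 'rV[R[i]]_n) :
  row_mx a a *m Qmx F G *m col_mx 1%:M 0 = a *m (F + G).
Proof.
by rewrite -mulmxA /Qmx mul_block_col !mulmx1 !mulmx0 !addr0 mul_row_col -mulmxDr.
Qed.

(** A row vector (a, b) killed by R has b = a by the column difference, then a = 0 by the first
    column, as S is injective. Without invertibility [invmx] would not be a true inverse. *)
Lemma Rmx_unit F G : hermitian_posdef F -> pos_semidef G ->
  Rmx F G \in unitmx.
Proof.
move=> hF hG; rewrite -row_free_unit; apply/inj_row_free => z.
rewrite -[z]hsubmxK; set a := lsubmx z; set b := rsubmx z => zR0.
have /hpart_row_inj : (b - a) *m hpart F G = 0 by rewrite -Rmx_diff zR0 mul0mx.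
move=> /(_ hF hG) /subr0_eq ba; rewrite ba in zR0 *.
have /hpart_row_inj : a *m hpart F G = 0 by rewrite -Rmx_diag zR0 mul0mx.
by move=> /(_ hF hG) ->; rewrite row_mx0.
Qed.

End HermitianPart.

Theorem theorem1 (R : realType) (n : nat) (F G : 'M[R[i]]_n)
    (hF : hermitian_posdef F) (hG : pos_semidef G) (lambda : R[i])
    (hlambda : eigenvalue (invmx (Rmx F G) *m Qmx F G) lambda) :
  'Re lambda = 1 /\
  exists x : 'cV[R[i]]_n, x != 0 /\
    let q := (2 * 'i)^-1 *
      (qform (G ^t* - G) x / qform (F + 2^-1 *: (G + G ^t*)) x) in
    'Im lambda = q \/ 'Im lambda = - q.
Proof.
have uR := Rmx_unit hF hG.
have /eigenvalueP[w] := hlambda.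
(* [eigenvalue] speaks of row vectors w; z = w R^-1 satisfies z Q = lambda z R. *)
rewrite mulmxA -{2 3}(mulmxKV uR w); set z := w *m invmx _ => zQ z0.
have {z0} : z != 0 by apply: contra_neq z0 => ->; rewrite mul0mx.
move: zQ; rewrite -[z]hsubmxK; set a := lsubmx z; set b := rsubmx z => zQ z0.
have [ab|ab] := eqVneq (b - a) 0.
  move: zQ z0; rewrite (subr0_eq ab) => zQ.
  have [->|a0 _] := eqVneq a 0; first by rewrite row_mx0 eqxx.
  have [|Re1 Imq] := @hpart_eigen _ _ F G a lambda hF hG a0.
    by rewrite -Qmx_diag -Rmx_diag zQ -scalemxAl.
  by split=> //; exists (a ^t*); split; [rewrite adj_eq0 | right].
have hG' := pos_semidef_adj hG.
have [|Re1 Imq] := @hpart_eigen _ _ F (G ^t*) (b - a) lambda hF hG' ab.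
  by rewrite hpart_adj -Qmx_diff -Rmx_diff zQ -scalemxAl.
split=> //; exists ((b - a) ^t*); split; first by rewrite adj_eq0.
(* For G^* the numerator is G - G^* = - (G^* - G), hence the sign opposite to that of the case b =
   a. *)
left; rewrite Imq hpart_adj trmxCK -[G - _]opprB qformN -/(hpart F G).
by rewrite mulNr mulrN opprK.
Qed.
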